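(* Let $\delta,\rho,H>0$ satisfy $1<\frac{\rho}{\delta+H}\leq e$ and put $\kappa=\ln\left(\frac{\rho}{\delta+H}\right)$. Let $\sigma_0>0$ be the unique number satisfying $H\sigma_0e^{1+\delta\sigma_0}=1$. If $0<r\leq\sigma\leq\sigma_0$, then the delay differential equation $$n'(t)=-\delta n(t)-H n(t-\sigma)+\rho n(t-r)e^{-n(t-r)},\qquad t\in\mathbb R,$$ admits a monotone heteroclinic solution $n_*:\mathbb R\to\mathbb R$ connecting $0$ to $\kappa$. More precisely, $$n_*'(t)\geq0\ \ (t\in\mathbb R),\qquad \lim_{t\to-\infty}n_*(t)=0,\qquad \lim_{t\to+\infty}n_*(t)=\kappa.$$
   Context: A heteroclinic solution connecting $0$ to $\kappa$ is a solution of the delay equation defined on all of $\mathbb R$ which tends to the equilibrium $0$ at $-\infty$ and to the equilibrium $\kappa$ at $+\infty$. *)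

(* Defs.v *)
From Stdlib Require Import Reals Lra.
From Coquelicot Require Import Coquelicot.

Open Scope R_scope.

(* [is_derive] at every t carries the differentiability of n on all of R. *)
Definition is_entire_solution (delta H rho sigma r : R) (n : R -> R) : Prop :=
  forall t : R,
    is_derive n t
      (- delta * n t - H * n (t - sigma) + rho * n (t - r) * exp (- n (t - r))).

Definition is_equilibrium (delta H rho sigma r a : R) : Prop :=
  is_entire_solution delta H rho sigma r (fun _ => a).

Definition is_heteroclinic (delta H rho sigma r a b : R) (n : R -> R) : Prop :=
  is_equilibrium delta H rho sigma r a /\
  is_equilibrium delta H rho sigma r b /\
  is_entire_solution delta H rho sigma r n /\
  is_lim n m_infty a /\
  is_lim n p_infty b.

Definition critical_delay_eq (delta H s : R) : Prop :=
  0 < s /\ H * s * exp (1 + delta * s) = 1.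

(* The critical delay is well defined, so that assuming
   [unique (critical_delay_eq delta H) sigma0] merely names it. *)
Lemma critical_delay_exists_unique (delta H : R) :
  0 < delta -> 0 < H -> exists! s : R, critical_delay_eq delta H s.
Proof.
intros hd hH.
assert (hinv : 0 < / H) by (now apply Rinv_0_lt_compat).
destruct (IVT (fun s => H * s * exp (1 + delta * s) - 1) 0 (/ H))
  as [z [[hz0 _] hz]].
- intros x; apply derivable_continuous_pt, ex_derive_Reals_0; auto_derive; exact I.
- exact hinv.
- lra.
- rewrite Rinv_r, Rmult_1_l by lra.
  assert (h : 0 < 1 + delta * / H)
    by (assert (0 < delta * / H) by (now apply Rmult_lt_0_compat); lra).
  generalize (exp_ineq1 _ (Rgt_not_eq _ _ h)); lra.
- assert (hz' : critical_delay_eq delta H z).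
  { split; [| lra].
    destruct hz0 as [h | h]; [exact h | subst z; lra]. }
  assert (mono : forall x y, 0 < x -> x < y ->
    H * x * exp (1 + delta * x) < H * y * exp (1 + delta * y)).
  { intros x y hx hxy.
    apply Rmult_gt_0_lt_compat.
    - apply exp_pos.
    - apply Rmult_lt_0_compat; lra.
    - apply Rmult_lt_compat_l; lra.
    - apply exp_increasing, Rplus_lt_compat_l, Rmult_lt_compat_l; lra. }
  exists z; split; [exact hz' |].
  intros y [hy hye]; destruct hz' as [hzp hze].
  destruct (Rtotal_order z y) as [h | [h | h]]; [| exact h |].
  + generalize (mono _ _ hzp h); lra.
  + generalize (mono _ _ hy h); lra.
Qed.

(* Main.v *)
Require Import Defs.
From Stdlib Require Import Reals Lra.
From Coquelicot Require Import Coquelicot.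

Open Scope R_scope.

(** The solution is the limit of a monotone iteration.  Write [f u = rho u e^(-u)],
    which increases on [0, 1] and hence on [0, kappa].  The term [- H n(t - sigma)]
    spoils a direct comparison argument, and the smallness of [sigma] repairs it:
    since [H sigma e^(1 + delta sigma) <= 1], there is [mu > delta] with
    [mu - delta = H e^(mu sigma)] (lemma [decay_rate_exists]).  Adding [mu n] on both
    sides, the equation becomes
    [n' + mu n = g] with [g(t) = (mu - delta) n(t) - H n(t - sigma) + f(n(t - r))].

    Suppose that [m' + mu m = d >= 0] and that [m] is bounded near minus infinity.
    Then [e^(mu t) m(t)] is nondecreasing and tends to 0 at minus infinity, so
    [m >= 0] and [H m(t - sigma) <= H e^(mu sigma) m(t) = (mu - delta) m(t)].
    Applied to a difference [m = n2 - n1], this says that the whole map from the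
    source [g] to the profile [n] and on to the next source is order preserving
    ([delayed_part_order], [forcing_order]).  Applied to a time translate, it says
    that this map preserves monotonicity in [t].

    It remains to trap the iterates.  Let [lam > 0] be the growth rate of the
    linearisation at 0, so that [lam + delta + H e^(-lam sigma) = rho e^(-lam r)].
    The equilibrium [kappa] is a supersolution, and so is [e^(lam t)], because
    [f u <= rho u]; the function [e^(lam t) - M e^(2 lam t)] is a subsolution for
    large [M], because [f u >= rho u - rho u^2] and because the characteristic
    function is positive at [2 lam] ([characteristic_double_pos]).  Hence the sources
    lying between the corresponding bounds form a class stable under the iteration
    ([forcing_resolvent_admissible]), and the iterates that start from the minimum of
    the two upper sources decrease to a limit.

    The limit profile is nondecreasing, lies below [kappa] and between the sub- and
    the supersolution.  It solves the equation because, all sources being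
    nondecreasing, the secants of [e^(mu t) n(t)] are squeezed between the values of
    [e^(mu t) g(t)] at the two ends, a property that survives pointwise limits.  It
    tends to 0 at minus infinity below [e^(lam t)]; at plus infinity it tends to a
    positive equilibrium, because the subsolution is positive somewhere, and
    [kappa] is the only one. *)

(** * Real functions of one variable *)

Lemma is_derive_continuity_pt (f : R -> R) (t l : R) :
  is_derive f t l -> continuity_pt f t.
Proof.
intros h; apply derivable_continuous_pt; exists l; now apply is_derive_Reals.
Qed.

Lemma nondecreasing_of_derive_nonneg (F D : R -> R) :
  (forall t, is_derive F t (D t)) -> (forall t, 0 <= D t) ->
  forall s t, s <= t -> F s <= F t.
Proof.
intros hF hD s t hst.
destruct (MVT_gen F s t D) as [c [_ hc]].
- intros x _; apply hF.
- intros x _; exact (is_derive_continuity_pt _ _ _ (hF x)).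
- assert (0 <= D c * (t - s)) by (apply Rmult_le_pos; [apply hD | lra]); lra.
Qed.

Lemma continuous_of_lipschitz (n : R -> R) (C : R) :
  0 <= C -> (forall s t, s <= t -> 0 <= n t - n s <= C * (t - s)) ->
  forall t, continuous n t.
Proof.
intros hC h t.
apply continuity_pt_filterlim; intros eps heps.
exists (eps / (C + 1)); split.
- apply Rdiv_lt_0_compat; lra.
- intros x [_ hx]; simpl in hx; unfold R_dist in *.
  apply Rlt_div_r in hx; [| lra].
  revert hx; simpl; unfold R_dist.
  destruct (Rle_lt_dec t x) as [htx | htx].
  + generalize (h _ _ htx); intros; rewrite Rabs_pos_eq in * by lra; nra.
  + generalize (h x t (Rlt_le _ _ htx)); intros.
    rewrite (Rabs_left (x - t)) in hx by lra.
    rewrite Rabs_left1 by lra; nra.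
Qed.

(** The hypotheses are those satisfied by a primitive of a nondecreasing continuous
    function; being non-strict inequalities between values, they are stable under
    pointwise limits, unlike differentiability. *)
Lemma is_derive_of_secant_bounds (N D : R -> R) :
  (forall t, continuous D t) ->
  (forall s t, s <= t -> (t - s) * D s <= N t - N s <= (t - s) * D t) ->
  forall t, is_derive N t (D t).
Proof.
intros hD h t.
apply is_derive_Reals; intros eps heps.
assert (hc := hD t); apply continuity_pt_filterlim in hc.
destruct (hc eps heps) as [alp [halp hc']].
exists (mkposreal alp halp); intros x hx0 hx; simpl in hx.
assert (hd : Rabs (D (t + x) - D t) < eps).
{ apply (hc' (t + x)); split.
  - split; [exact I | lra].
  - simpl; unfold R_dist; now replace (t + x - t) with x by ring. }
apply Rle_lt_trans with (2 := hd).
assert (hq : (N (t + x) - N t) / x - D t = (N (t + x) - N t - x * D t) / x)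
  by (now field).
rewrite hq, Rabs_div by assumption.
assert (hax : 0 < Rabs x) by now apply Rabs_pos_lt.
apply Rle_div_l; [exact hax |].
rewrite <- Rabs_mult.
destruct (Rle_lt_dec 0 x) as [h0 | h0].
- generalize (h t (t + x) ltac:(lra)); intros.
  rewrite !Rabs_pos_eq; nra.
- generalize (h (t + x) t ltac:(lra)); intros.
  rewrite !Rabs_pos_eq; nra.
Qed.

Lemma continuous_shift (n : R -> R) (a t : R) :
  (forall t, continuous n t) -> continuous (fun t => n (t - a)) t.
Proof.
intros h; apply (continuous_comp (fun t => t - a) n); [| apply h].
apply (ex_derive_continuous (fun t => t - a)); auto_derive; exact I.
Qed.

Lemma continuous_Rmin (f g : R -> R) (t : R) :
  continuous f t -> continuous g t -> continuous (fun t => Rmin (f t) (g t)) t.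
Proof.
intros hf hg.
apply (continuous_ext (fun t => / 2 * (f t + g t - Rabs (f t - g t)))).
- intros u; unfold Rmin; destruct Rle_dec; [rewrite Rabs_left1 | rewrite Rabs_pos_eq]; lra.
- apply (continuous_scal_r (/ 2) (fun t => f t + g t - Rabs (f t - g t))).
  apply (continuous_minus (fun t => f t + g t) (fun t => Rabs (f t - g t))).
  + now apply (continuous_plus f g).
  + apply (continuous_comp (fun t => f t - g t) Rabs); [| apply continuous_Rabs].
    now apply (continuous_minus f g).
Qed.

(** By the mean value theorem [n (t + 1) - n t], which tends to 0, is a value of [d]
    far to the right. *)
Lemma derive_limit_zero (n d : R -> R) (l c : R) :
  (forall t, is_derive n t (d t)) ->
  is_lim n p_infty l -> is_lim d p_infty c -> c = 0.
Proof.
intros hn hl hc.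
destruct (Req_dec c 0) as [h | h]; [exact h | exfalso].
assert (he : 0 < Rabs c / 4) by (generalize (Rabs_pos_lt _ h); lra).
apply is_lim_spec in hl; apply is_lim_spec in hc.
destruct (hl (mkposreal _ he)) as [A hA]; destruct (hc (mkposreal _ he)) as [B hB].
simpl in hA, hB.
set (t := Rmax A B + 1).
assert (hAt : A < t) by (unfold t; generalize (Rmax_l A B); lra).
assert (hBt : B < t) by (unfold t; generalize (Rmax_r A B); lra).
destruct (MVT_gen n t (t + 1) d) as [x [hx hx']].
- intros y _; apply hn.
- intros y _; exact (is_derive_continuity_pt _ _ _ (hn y)).
- rewrite Rmin_left, Rmax_right in hx by lra.
  generalize (hA t hAt) (hA (t + 1) ltac:(lra)) (hB x ltac:(lra)).
  replace (d x) with (n (t + 1) - n t) by lra.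
  clear; unfold Rabs; repeat destruct Rcase_abs; lra.
Qed.

Lemma is_lim_nondecreasing_bounded (n : R -> R) (B : R) :
  (forall s t, s <= t -> n s <= n t) -> (forall t, n t <= B) ->
  exists l : R, is_lim n p_infty l /\ forall t, n t <= l.
Proof.
intros hmono hB.
destruct (completeness (fun x => exists t, x = n t)) as [l [hub hlub]].
- exists B; intros x [t ->]; apply hB.
- exists (n 0); now exists 0.
- assert (hle : forall t, n t <= l) by (intros t; apply hub; now exists t).
  exists l; split; [| exact hle].
  apply is_lim_spec; intros eps.
  assert (hs : exists s, l - eps < n s).
  { apply Classical_Prop.NNPP; intros hn.
    assert (l <= l - eps); [| generalize (cond_pos eps); lra].
    apply (hlub (l - eps)); intros x [t ->].
    destruct (Rle_lt_dec (n t) (l - eps)) as [h | h]; [exact h |].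
    exfalso; apply hn; now exists t. }
  destruct hs as [s hs]; exists s; intros x hx.
  generalize (hmono s x ltac:(lra)) (hle x) (cond_pos eps); intros.
  apply Rabs_def1; lra.
Qed.

Lemma is_lim_shift_p_infty (n : R -> R) (a l : R) :
  is_lim n p_infty l -> is_lim (fun t => n (t - a)) p_infty l.
Proof.
intros h; apply is_lim_ext with (fun t => n (1 * t + - a)).
- intros t; f_equal; ring.
- apply is_lim_comp_lin; [| lra].
  replace (Rbar_plus (Rbar_mult 1 p_infty) (- a)) with p_infty; [exact h |].
  simpl; destruct (Rle_dec 0 1) as [h1 | h1]; [| exfalso; lra].
  destruct (Rle_lt_or_eq_dec 0 1 h1); [reflexivity | exfalso; lra].
Qed.

(** * The operator d/dt + mu *)

(** [n' + mu n = g] on the whole line. *)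
Definition damped (mu : R) (n g : R -> R) : Prop :=
  forall t, is_derive n t (g t - mu * n t).

(** Selects the one solution of [n' + mu n = g] without a multiple of [e^(-mu t)],
    which blows up at minus infinity. *)
Definition bounded_past (n : R -> R) : Prop :=
  exists B, forall t, t <= 0 -> Rabs (n t) <= B.

(** [e^(mu t)] is the integrating factor of the operator. *)
Lemma damped_weighted (mu : R) (n g : R -> R) :
  damped mu n g ->
  forall t, is_derive (fun t => exp (mu * t) * n t) t (exp (mu * t) * g t).
Proof.
intros h t; generalize (h t); intros ht.
auto_derive; [now exists (g t - mu * n t) |].
rewrite (is_derive_unique (fun x : R => n x) _ _ ht); ring.
Qed.

Lemma damped_minus (mu : R) (n1 g1 n2 g2 : R -> R) :
  damped mu n1 g1 -> damped mu n2 g2 ->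
  damped mu (fun t => n2 t - n1 t) (fun t => g2 t - g1 t).
Proof.
intros h1 h2 t; generalize (is_derive_minus _ _ _ _ _ (h2 t) (h1 t)).
intros h; replace (g2 t - g1 t - mu * (n2 t - n1 t))
  with (minus (g2 t - mu * n2 t) (g1 t - mu * n1 t)); [exact h |].
unfold minus, plus, opp; simpl; ring.
Qed.

Lemma bounded_past_minus (n1 n2 : R -> R) :
  bounded_past n1 -> bounded_past n2 -> bounded_past (fun t => n2 t - n1 t).
Proof.
intros [B1 h1] [B2 h2]; exists (B2 + B1); intros t ht.
generalize (h1 t ht) (h2 t ht) (Rabs_triang (n2 t) (- n1 t)).
rewrite Rabs_Ropp; unfold Rminus; lra.
Qed.

Lemma bounded_past_of_bounds (n : R -> R) (C : R) :
  (forall t, 0 <= n t <= C) -> bounded_past n.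
Proof.
intros h; exists C; intros t _; rewrite Rabs_pos_eq; apply h.
Qed.

Lemma damped_shift (mu a : R) (n g : R -> R) :
  damped mu n g -> damped mu (fun t => n (t + a)) (fun t => g (t + a)).
Proof.
intros h t; generalize (h (t + a)); intros ht.
apply (is_derive_ext (fun t => n (t + a))); [reflexivity |].
evar_last.
- apply (is_derive_comp n (fun t => t + a)); [exact ht |].
  apply (is_derive_plus (fun t => t) (fun _ => a));
    [apply is_derive_id | apply is_derive_const].
- unfold scal, plus, zero, one; simpl; unfold mult; simpl; ring.
Qed.

Lemma damped_const (mu c : R) : damped mu (fun _ => c) (fun _ => mu * c).
Proof. intros t; auto_derive; [exact I | ring]. Qed.

Lemma damped_exp_nondecreasing (mu : R) (m d : R -> R) :
  damped mu m d -> (forall t, 0 <= d t) ->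
  forall s t, s <= t -> exp (mu * s) * m s <= exp (mu * t) * m t.
Proof.
intros hm hd; apply nondecreasing_of_derive_nonneg with (fun t => exp (mu * t) * d t).
- now apply damped_weighted.
- intros t; apply Rmult_le_pos; [apply Rlt_le, exp_pos | apply hd].
Qed.

(** [e^(mu t) m t] is nondecreasing, and its limit at minus infinity is 0 since [m] is
    bounded there. *)
Lemma damped_nonneg (mu : R) (m d : R -> R) :
  0 < mu -> damped mu m d -> bounded_past m -> (forall t, 0 <= d t) ->
  forall t, 0 <= m t.
Proof.
intros hmu hm [B hB] hd t.
destruct (Rle_lt_dec 0 (m t)) as [h | h]; [exact h | exfalso].
assert (hB0 : 0 <= B).
{ apply Rle_trans with (2 := hB 0 (Rle_refl 0)); apply Rabs_pos. }
set (c := - (exp (mu * t) * m t)).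
assert (hc : 0 < c) by (unfold c; generalize (exp_pos (mu * t)); nra).
(* So far to the left that the bound [B e^(mu s)] is below [c]. *)
set (s := Rmin (Rmin t 0) (ln (c / (B + 1)) / mu)).
assert (hst : s <= t) by (unfold s; eapply Rle_trans; [apply Rmin_l | apply Rmin_l]).
assert (hs0 : s <= 0) by (unfold s; eapply Rle_trans; [apply Rmin_l | apply Rmin_r]).
assert (hsl : s <= ln (c / (B + 1)) / mu) by (unfold s; apply Rmin_r).
assert (hcB : 0 < c / (B + 1)) by (apply Rdiv_lt_0_compat; lra).
assert (hexp : exp (mu * s) <= c / (B + 1)).
{ rewrite <- (exp_ln (c / (B + 1))) by exact hcB.
  apply Rle_div_r in hsl; [| exact hmu].
  destruct (Rle_lt_or_eq_dec _ _ hsl) as [h1 | h1].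
  - apply Rlt_le, exp_increasing; lra.
  - right; f_equal; lra. }
apply Rle_div_r in hexp; [| lra].
generalize (damped_exp_nondecreasing mu m d hm hd s t hst); fold c.
generalize (hB s hs0) (exp_pos (mu * s)).
intros h1 h2; apply Rabs_le_between in h1.
replace (exp (mu * t) * m t) with (- c) by (unfold c; ring); nra.
Qed.

(** This is the integral of [e^(- mu (t - u)) g u] over [u <= t].  For [g >= 0] the
    part over [u <= 0] is the supremum of the proper integrals, so that no improper
    integral has to be differentiated. *)
Definition resolvent (mu : R) (g : R -> R) (t : R) : R :=
  exp (- (mu * t)) *
  (real (Lub_Rbar (fun x => exists s, x = RInt (fun u => exp (mu * u) * g u) s 0))
   + RInt (fun u => exp (mu * u) * g u) 0 t).

Lemma real_Lub_spec (E : R -> Prop) (x0 B : R) :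
  E x0 -> (forall x, E x -> x <= B) ->
  (forall x, E x -> x <= real (Lub_Rbar E)) /\
  (forall b, (forall x, E x -> x <= b) -> real (Lub_Rbar E) <= b).
Proof.
intros h0 hB; destruct (Lub_Rbar_correct E) as [hub hlub].
assert (hx0 := hub x0 h0).
assert (hLB : Rbar_le (Lub_Rbar E) B) by (apply hlub; exact hB).
destruct (Lub_Rbar E) as [L | |]; simpl in *; try contradiction.
split; [exact hub | intros b hb; apply (hlub (Finite b)); exact hb].
Qed.

Lemma resolvent_spec (mu C : R) (g : R -> R) :
  0 < mu -> (forall t, continuous g t) -> (forall t, 0 <= g t <= C) ->
  damped mu (resolvent mu g) g /\ forall t, 0 <= resolvent mu g t <= C / mu.
Proof.
intros hmu hcont hg.
set (h := fun u => exp (mu * u) * g u).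
assert (hh : forall u, continuous h u).
{ intros u; apply (continuous_mult (fun u => exp (mu * u)) g); [| apply hcont].
  apply (ex_derive_continuous (fun u => exp (mu * u))); auto_derive; exact I. }
assert (hint : forall a b, ex_RInt h a b).
{ intros a b; apply (ex_RInt_continuous h); intros; apply hh. }
set (I := fun t => RInt h 0 t).
assert (hI : forall t, is_derive I t (h t)).
{ intros t; apply (is_derive_RInt h I 0); [| apply hh].
  apply filter_forall; intros b; apply (RInt_correct h), hint. }
assert (hI0 : I 0 = 0) by (unfold I; now rewrite RInt_point).
assert (hswap : forall s, RInt h s 0 = - I s).
{ intros s; unfold I; rewrite <- (opp_RInt_swap h 0 s) by apply hint.
  reflexivity. }
assert (hImono : forall s t, s <= t -> I s <= I t).
{ apply nondecreasing_of_derive_nonneg with h; [exact hI |].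
  intros t; apply Rmult_le_pos; [apply Rlt_le, exp_pos | apply hg]. }
(* The same monotonicity for the integrand [e^(mu u) (C - g u)]: it bounds all the
   integrals over [s, t], uniformly in [s]. *)
assert (hIup : forall s t, s <= t ->
  C / mu * exp (mu * s) - I s <= C / mu * exp (mu * t) - I t).
{ apply nondecreasing_of_derive_nonneg with (fun t => exp (mu * t) * (C - g t)).
  - intros t; generalize (hI t); intros ht.
    auto_derive; [now exists (h t) |].
    rewrite (is_derive_unique (fun x : R => I x) _ _ ht); unfold h; field; lra.
  - intros t; apply Rmult_le_pos; [apply Rlt_le, exp_pos |].
    generalize (hg t); lra. }
assert (hC : 0 <= C / mu).
{ apply Rmult_le_pos; [generalize (hg 0); lra | apply Rlt_le, Rinv_0_lt_compat, hmu]. }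
assert (hbd : forall s t, - I s <= - I t + C / mu * exp (mu * t)).
{ intros s t; destruct (Rle_lt_dec s t) as [hst | hst].
  - generalize (hIup s t hst) (exp_pos (mu * s)); nra.
  - generalize (hImono t s (Rlt_le _ _ hst)) (exp_pos (mu * t)); nra. }
set (E := fun x => exists s, x = RInt h s 0).
destruct (real_Lub_spec E 0 (- I 0 + C / mu * exp (mu * 0))) as [hub hlub].
- exists 0; now rewrite RInt_point.
- intros x [s ->]; rewrite hswap; apply hbd.
- set (c := real (Lub_Rbar E)) in *.
  assert (hres : forall t, resolvent mu g t = exp (- (mu * t)) * (c + I t))
    by reflexivity.
  split.
  + intros t; apply is_derive_ext with (fun t => exp (- (mu * t)) * (c + I t));
      [intros; now rewrite hres |].
    generalize (hI t); intros ht.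
    auto_derive; [now exists (h t) |].
    rewrite (is_derive_unique (fun x : R => I x) _ _ ht), hres; unfold h.
    replace (g t) with (exp (- (mu * t)) * (exp (mu * t) * g t)) at 2; [ring |].
    rewrite <- Rmult_assoc, <- exp_plus.
    replace (- (mu * t) + mu * t) with 0 by ring; rewrite exp_0; ring.
  + intros t; rewrite hres.
    assert (h1 : 0 <= c + I t).
    { assert (- I t <= c) by (apply hub; exists t; now rewrite hswap); lra. }
    assert (h2 : c <= - I t + C / mu * exp (mu * t)).
    { apply hlub; intros x [s ->]; rewrite hswap; apply hbd. }
    generalize (exp_pos (- (mu * t))); intros hp.
    split; [apply Rmult_le_pos; lra |].
    apply Rle_trans with (exp (- (mu * t)) * (C / mu * exp (mu * t))).
    * apply Rmult_le_compat_l; lra.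
    * right; transitivity (C / mu * (exp (- (mu * t)) * exp (mu * t))); [ring |].
      rewrite <- exp_plus; replace (- (mu * t) + mu * t) with 0 by ring.
      rewrite exp_0; ring.
Qed.

(** The second conclusion is the order that copes with a negative delayed term: the
    difference of the profiles cannot decay faster than [e^(- mu t)]. *)
Lemma damped_order (mu : R) (n1 g1 n2 g2 : R -> R) :
  0 < mu -> damped mu n1 g1 -> damped mu n2 g2 ->
  bounded_past n1 -> bounded_past n2 -> (forall t, g1 t <= g2 t) ->
  forall t, n1 t <= n2 t /\
    forall s, 0 <= s ->
      exp (mu * (t - s)) * (n2 (t - s) - n1 (t - s)) <= exp (mu * t) * (n2 t - n1 t).
Proof.
intros hmu h1 h2 b1 b2 hg t.
assert (hd := damped_minus _ _ _ _ _ h1 h2).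
assert (hg' : forall t, 0 <= g2 t - g1 t) by (intros u; generalize (hg u); lra).
split.
- generalize (damped_nonneg mu _ _ hmu hd (bounded_past_minus _ _ b1 b2) hg' t); lra.
- intros s hs; apply (damped_exp_nondecreasing mu _ _ hd hg'); lra.
Qed.

(** * The birth function *)

Definition ricker (rho u : R) : R := rho * u * exp (- u).

Lemma ricker_nondecreasing (rho u v : R) :
  0 <= rho -> 0 <= u -> u <= v -> v <= 1 -> ricker rho u <= ricker rho v.
Proof.
intros hr hu huv hv; unfold ricker; rewrite !Rmult_assoc.
apply Rmult_le_compat_l; [exact hr |].
replace (- v) with (- u + (u - v)) by ring; rewrite exp_plus.
generalize (exp_ineq1_le (u - v)) (exp_pos (- u)); intros h1 h2.
(* [v e^(u - v) >= v (1 + u - v) = u + (1 - v) (v - u)]. *)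
assert (h3 : u <= v * exp (u - v)) by nra.
nra.
Qed.

Lemma ricker_le_linear (rho u : R) : 0 <= rho -> 0 <= u -> ricker rho u <= rho * u.
Proof.
intros hr hu; unfold ricker.
assert (h : exp (- u) <= 1).
{ rewrite <- exp_0; destruct hu as [hu | <-];
  [apply Rlt_le, exp_increasing; lra | right; f_equal; ring]. }
generalize (Rmult_le_pos _ _ hr hu); nra.
Qed.

Lemma ricker_ge_quadratic (rho u : R) :
  0 <= rho -> 0 <= u -> rho * u - rho * (u * u) <= ricker rho u.
Proof.
intros hr hu; unfold ricker.
generalize (exp_ineq1_le (- u)) (Rmult_le_pos _ _ hr hu); nra.
Qed.

Lemma continuous_ricker (rho u : R) : continuous (ricker rho) u.
Proof.
apply (ex_derive_continuous (ricker rho)); unfold ricker; auto_derive; exact I.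
Qed.

(** * The monotone iteration *)

Section MonotoneScheme.

Context (delta rho H sigma r kappa mu lam M : R).
(** [mu] is the rate that absorbs the delayed death term and [lam] the growth rate of
    the linearisation at 0.  The two conditions on [M] make
    [e^(lam t) - M e^(2 lam t)] a subsolution and put its source below [mu * kappa]. *)
Context (hdelta : 0 < delta) (hrho : 0 < rho) (hH : 0 < H)
  (hsigma : 0 < sigma) (hr : 0 < r) (hkappa : 0 < kappa <= 1)
  (hequil : rho * exp (- kappa) = delta + H)
  (hmu : mu - delta = H * exp (mu * sigma))
  (hlam : 0 < lam)
  (hchar : lam + delta + H * exp (- (lam * sigma)) = rho * exp (- (lam * r)))
  (hM : 0 < M)
  (hM_sub : rho * exp (- (lam * r)) ^ 2
      <= M * (2 * lam + delta + H * exp (- (lam * sigma)) ^ 2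
              - rho * exp (- (lam * r)) ^ 2))
  (hM_top : (lam + mu) ^ 2 <= 4 * (M * (2 * lam + mu)) * (mu * kappa)).

(** A solution of the delay equation is a solution of [n' + mu n = forcing n]. *)
Definition forcing (n : R -> R) (t : R) : R :=
  (mu - delta) * n t - H * n (t - sigma) + ricker rho (n (t - r)).

Lemma mu_gt_delta : delta < mu.
Proof. generalize (exp_pos (mu * sigma)); nra. Qed.

Lemma mu_pos : 0 < mu.
Proof. generalize mu_gt_delta; lra. Qed.

(** The role of the choice of [mu]: over one delay the difference of the profiles drops
    at most by the factor [e^(- mu sigma)], and [H e^(mu sigma) = mu - delta]. *)
Lemma delayed_part_order (n1 g1 n2 g2 : R -> R) :
  damped mu n1 g1 -> damped mu n2 g2 ->
  bounded_past n1 -> bounded_past n2 -> (forall t, g1 t <= g2 t) ->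
  forall t, n1 t <= n2 t /\
    (mu - delta) * n1 t - H * n1 (t - sigma)
    <= (mu - delta) * n2 t - H * n2 (t - sigma).
Proof.
intros h1 h2 b1 b2 hg t.
destruct (damped_order mu _ _ _ _ mu_pos h1 h2 b1 b2 hg t) as [hle hexp].
split; [exact hle |].
generalize (hexp sigma (Rlt_le _ _ hsigma)).
replace (mu * t) with (mu * (t - sigma) + mu * sigma) by ring.
rewrite exp_plus, Rmult_assoc; intros h.
apply Rmult_le_reg_l in h; [| apply exp_pos].
assert (h' : H * (n2 (t - sigma) - n1 (t - sigma)) <= (mu - delta) * (n2 t - n1 t)).
{ rewrite hmu, Rmult_assoc; apply Rmult_le_compat_l; lra. }
lra.
Qed.

(** The bound [kappa <= 1] enters here, to stay where the birth function increases. *)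
Lemma forcing_order (n1 g1 n2 g2 : R -> R) :
  damped mu n1 g1 -> damped mu n2 g2 ->
  (forall t, 0 <= n1 t <= kappa) -> (forall t, 0 <= n2 t <= kappa) ->
  (forall t, g1 t <= g2 t) ->
  forall t, forcing n1 t <= forcing n2 t.
Proof.
intros h1 h2 b1 b2 hg t; unfold forcing.
assert (hord := delayed_part_order n1 g1 n2 g2 h1 h2
  (bounded_past_of_bounds _ _ b1) (bounded_past_of_bounds _ _ b2) hg).
apply Rplus_le_compat; [apply hord |].
apply ricker_nondecreasing; try lra.
- apply b1.
- apply hord.
- generalize (b2 (t - r)); lra.
Qed.

Lemma forcing_continuous (n : R -> R) :
  (forall t, continuous n t) -> forall t, continuous (forcing n) t.
Proof.
intros hn t; unfold forcing.
apply (continuous_plus (fun t => (mu - delta) * n t - H * n (t - sigma))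
  (fun t => ricker rho (n (t - r)))).
- apply (continuous_minus (fun t => (mu - delta) * n t) (fun t => H * n (t - sigma))).
  + apply (continuous_scal_r (mu - delta) n), hn.
  + apply (continuous_scal_r H (fun t => n (t - sigma))), continuous_shift, hn.
- apply (continuous_comp (fun t => n (t - r)) (ricker rho)).
  + apply continuous_shift, hn.
  + apply continuous_ricker.
Qed.

Definition super_exp (t : R) : R := exp (lam * t).
Definition sub_exp (t : R) : R := exp (lam * t) - M * exp (lam * t) ^ 2.

(** The sources [n' + mu n] of the exponential super- and subsolution. *)
Definition super_exp_source (t : R) : R := (lam + mu) * exp (lam * t).
Definition sub_exp_source (t : R) : R :=
  (lam + mu) * exp (lam * t) - M * (2 * lam + mu) * exp (lam * t) ^ 2.

Lemma damped_super_exp : damped mu super_exp super_exp_source.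
Proof.
intros t; unfold super_exp, super_exp_source; auto_derive; [exact I | ring].
Qed.

Lemma damped_sub_exp : damped mu sub_exp sub_exp_source.
Proof.
intros t; unfold sub_exp, sub_exp_source; auto_derive; [exact I | simpl; ring].
Qed.

Lemma exp_past_le_1 (t : R) : t <= 0 -> 0 < exp (lam * t) <= 1.
Proof.
intros ht; split; [apply exp_pos |].
rewrite <- exp_0; destruct ht as [ht | ->].
- apply Rlt_le, exp_increasing; nra.
- right; f_equal; ring.
Qed.

Lemma bounded_past_super_exp : bounded_past super_exp.
Proof.
exists 1; intros t ht; generalize (exp_past_le_1 t ht); intros.
unfold super_exp; rewrite Rabs_pos_eq; lra.
Qed.

Lemma bounded_past_sub_exp : bounded_past sub_exp.
Proof.
exists (1 + M); intros t ht; generalize (exp_past_le_1 t ht); intros h.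
unfold sub_exp; apply Rabs_le.
assert (0 <= exp (lam * t) ^ 2 <= 1) by nra; nra.
Qed.

Lemma exp_lag (t a : R) : exp (lam * (t - a)) = exp (lam * t) * exp (- (lam * a)).
Proof. rewrite <- exp_plus; f_equal; ring. Qed.

(** The sources trapped between those of the super- and subsolutions. *)
Record admissible (g : R -> R) : Prop := {
  adm_continuous : forall t, continuous g t;
  adm_nondecreasing : forall s t, s <= t -> g s <= g t;
  adm_nonneg : forall t, 0 <= g t;
  adm_le_equilibrium : forall t, g t <= mu * kappa;
  adm_le_super : forall t, g t <= super_exp_source t;
  adm_ge_sub : forall t, sub_exp_source t <= g t
}.

Lemma resolvent_admissible (g : R -> R) :
  admissible g ->
  damped mu (resolvent mu g) g /\ forall t, 0 <= resolvent mu g t <= kappa.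
Proof.
intros hg.
replace kappa with (mu * kappa / mu) by (field; apply Rgt_not_eq, mu_pos).
apply resolvent_spec.
- exact mu_pos.
- apply (adm_continuous _ hg).
- split; [apply (adm_nonneg _ hg) | apply (adm_le_equilibrium _ hg)].
Qed.

Lemma resolvent_between_exp (g : R -> R) :
  admissible g ->
  forall t, sub_exp t <= resolvent mu g t <= super_exp t.
Proof.
intros hg; destruct (resolvent_admissible g hg) as [hd hb].
assert (hp := bounded_past_of_bounds _ _ hb).
intros t; split.
- apply (delayed_part_order _ _ _ _ damped_sub_exp hd bounded_past_sub_exp hp
    (adm_ge_sub _ hg)).
- apply (delayed_part_order _ _ _ _ hd damped_super_exp hp bounded_past_super_exp
    (adm_le_super _ hg)).
Qed.

(** The equation is autonomous: compare the profile with its own translate by [t - s]. *)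
Lemma resolvent_nondecreasing (g : R -> R) :
  admissible g ->
  forall s t, s <= t -> resolvent mu g s <= resolvent mu g t /\
    forcing (resolvent mu g) s <= forcing (resolvent mu g) t.
Proof.
intros hg s t hst; destruct (resolvent_admissible g hg) as [hd hb].
set (n := resolvent mu g) in *.
assert (hd' := damped_shift mu (t - s) n g hd).
assert (hb' : forall u, 0 <= n (u + (t - s)) <= kappa) by (intros u; apply hb).
assert (hgs : forall u, g u <= g (u + (t - s))).
{ intros u; apply (adm_nondecreasing _ hg); lra. }
assert (hn := delayed_part_order _ _ _ _ hd hd' (bounded_past_of_bounds _ _ hb)
  (bounded_past_of_bounds _ _ hb') hgs s).
assert (hf := forcing_order _ _ _ _ hd hd' hb hb' hgs s).
unfold forcing in hf |- *; cbv beta in hn.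
replace (s + (t - s)) with t in hn, hf by ring.
replace (s - sigma + (t - s)) with (t - sigma) in hf by ring.
replace (s - r + (t - s)) with (t - r) in hf by ring.
split; [apply hn | exact hf].
Qed.

Lemma forcing_equilibrium (t : R) : forcing (fun _ => kappa) t = mu * kappa.
Proof.
unfold forcing, ricker.
replace (rho * kappa * exp (- kappa)) with (kappa * (rho * exp (- kappa))) by ring.
rewrite hequil; ring.
Qed.

(** Each bound on the source is inherited from the comparison of [n] with the profile
    that generates this bound: 0, [kappa], [super_exp] or [sub_exp].  For the last
    one, the quadratic error of the linearisation is estimated by the supersolution,
    [n^2 <= e^(2 lam t)], and absorbed by the [M] term through [hM_sub]. *)
Lemma forcing_resolvent_admissible (g : R -> R) :
  admissible g -> admissible (forcing (resolvent mu g)).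
Proof.
intros hg; destruct (resolvent_admissible g hg) as [hd hb].
assert (hw := resolvent_between_exp g hg).
assert (hp := bounded_past_of_bounds _ _ hb).
set (n := resolvent mu g) in *.
assert (hconst : forall c, bounded_past (fun _ => c)).
{ intros c; exists (Rabs c); intros; apply Rle_refl. }
assert (hmukappa := Rmult_lt_0_compat _ _ mu_pos (proj1 hkappa)).
split.
- apply forcing_continuous; intros t.
  apply continuity_pt_filterlim, (is_derive_continuity_pt _ _ _ (hd t)).
- intros s t hst; apply (resolvent_nondecreasing g hg s t hst).
- intros t.
  replace 0 with (forcing (fun _ => 0) t) by (unfold forcing, ricker; ring).
  apply (forcing_order _ _ _ _ (damped_const mu 0) hd); [intros; lra | exact hb |].
  intros u; rewrite Rmult_0_r; apply (adm_nonneg _ hg).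
- intros t; rewrite <- (forcing_equilibrium t).
  apply (forcing_order _ _ _ _ hd (damped_const mu kappa)); [exact hb | intros; lra |].
  apply (adm_le_equilibrium _ hg).
- intros t.
  destruct (delayed_part_order _ _ _ _ hd damped_super_exp hp bounded_past_super_exp
    (adm_le_super _ hg) t) as [_ hdel].
  assert (hric : ricker rho (n (t - r)) <= rho * super_exp (t - r)).
  { apply Rle_trans with (rho * n (t - r)).
    - apply ricker_le_linear; [lra | apply hb].
    - apply Rmult_le_compat_l; [lra | apply hw]. }
  unfold forcing, super_exp_source, super_exp in *; rewrite exp_lag in hdel, hric.
  replace (lam + mu) with
    (mu - delta - H * exp (- (lam * sigma)) + rho * exp (- (lam * r))) by lra.
  lra.
- intros t.
  destruct (delayed_part_order _ _ _ _ damped_sub_exp hd bounded_past_sub_exp hp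
    (adm_ge_sub _ hg) t) as [_ hdel].
  assert (hric : rho * sub_exp (t - r) - rho * super_exp (t - r) ^ 2
                 <= ricker rho (n (t - r))).
  { eapply Rle_trans; [| apply ricker_ge_quadratic; [lra | apply hb]].
    destruct (hw (t - r)) as [h1 h2]; destruct (hb (t - r)) as [h3 _].
    assert (n (t - r) * n (t - r) <= super_exp (t - r) ^ 2) by nra.
    nra. }
  unfold forcing, sub_exp_source, sub_exp, super_exp in *.
  rewrite exp_lag in hdel, hric.
  replace (lam + mu) with
    (mu - delta - H * exp (- (lam * sigma)) + rho * exp (- (lam * r))) by lra.
  assert (hE : 0 <= exp (lam * t) ^ 2) by (apply pow2_ge_0).
  generalize (Rmult_le_compat_l _ _ _ hE hM_sub).
  lra.
Qed.

(** The minimum of two supersolution sources, iterated downwards. *)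
Definition iterate (k : nat) : R -> R :=
  Nat.iter k (fun g => forcing (resolvent mu g))
    (fun t => Rmin (mu * kappa) (super_exp_source t)).

Lemma iterate_0_admissible : admissible (iterate 0).
Proof.
assert (hmup := mu_pos).
assert (hmukappa := Rmult_lt_0_compat _ _ mu_pos (proj1 hkappa)).
assert (hinc : forall s t, s <= t -> super_exp_source s <= super_exp_source t).
{ intros s t hst; apply Rmult_le_compat_l; [lra |].
  destruct hst as [h | ->]; [apply Rlt_le, exp_increasing; nra | apply Rle_refl]. }
split; simpl.
- intros t; apply (continuous_Rmin (fun _ => mu * kappa) super_exp_source).
  + apply continuous_const.
  + apply (ex_derive_continuous super_exp_source); unfold super_exp_source.
    auto_derive; exact I.
- intros s t hst; apply Rmin_glb.
  + apply Rmin_l.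
  + eapply Rle_trans; [apply Rmin_r | now apply hinc].
- intros t; apply Rmin_glb; [lra |].
  apply Rmult_le_pos; [lra | apply Rlt_le, exp_pos].
- intros t; apply Rmin_l.
- intros t; apply Rmin_r.
- intros t; unfold sub_exp_source, super_exp_source; apply Rmin_glb.
  + set (x := exp (lam * t)).
    assert (hq : 0 < M * (2 * lam + mu)) by (apply Rmult_lt_0_compat; lra).
    set (q := M * (2 * lam + mu)) in *.
    (* The quadratic [(lam + mu) x - q x^2] is at most [(lam + mu)^2 / (4 q)]. *)
    apply Rmult_le_reg_l with (4 * q); [lra |].
    generalize (pow2_ge_0 (2 * q * x - (lam + mu))); nra.
  + generalize (pow2_ge_0 (exp (lam * t))); intros.
    assert (0 <= M * (2 * lam + mu)) by (apply Rmult_le_pos; lra); nra.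
Qed.

Lemma iterate_admissible (k : nat) : admissible (iterate k).
Proof.
induction k as [| k ih]; [exact iterate_0_admissible |].
now apply forcing_resolvent_admissible.
Qed.

Lemma iterate_decreasing (k : nat) (t : R) : iterate (S k) t <= iterate k t.
Proof.
revert t; induction k as [| k ih]; intros t.
- apply Rmin_glb; [apply (adm_le_equilibrium _ (iterate_admissible 1)) |].
  apply (adm_le_super _ (iterate_admissible 1)).
- destruct (resolvent_admissible _ (iterate_admissible k)) as [hd hb].
  destruct (resolvent_admissible _ (iterate_admissible (S k))) as [hd' hb'].
  exact (forcing_order _ _ _ _ hd' hd hb' hb ih t).
Qed.

(** * The limit profile *)

Definition profile (k : nat) : R -> R := resolvent mu (iterate k).

Definition limit_profile (t : R) : R := real (Lim_seq (fun k => profile k t)).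

Lemma profile_lim (t : R) : is_lim_seq (fun k => profile k t) (limit_profile t).
Proof.
apply Lim_seq_correct', (ex_finite_lim_seq_decr _ 0).
- intros k.
  destruct (resolvent_admissible _ (iterate_admissible k)) as [hd hb].
  destruct (resolvent_admissible _ (iterate_admissible (S k))) as [hd' hb'].
  apply (delayed_part_order _ _ _ _ hd' hd (bounded_past_of_bounds _ _ hb')
    (bounded_past_of_bounds _ _ hb) (iterate_decreasing k)).
- intros k; apply (resolvent_admissible _ (iterate_admissible k)).
Qed.

Lemma limit_profile_between (a b : R) (t : R) :
  (forall k, a <= profile k t <= b) -> a <= limit_profile t <= b.
Proof.
intros h; split.
- apply (is_lim_seq_le (fun _ => a) (fun k => profile k t) a (limit_profile t)).
  + intros k; apply h.
  + apply is_lim_seq_const.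
  + apply profile_lim.
- apply (is_lim_seq_le (fun k => profile k t) (fun _ => b) (limit_profile t) b).
  + intros k; apply h.
  + apply profile_lim.
  + apply is_lim_seq_const.
Qed.

Lemma iterate_lim (t : R) :
  is_lim_seq (fun k => iterate (S k) t) (forcing limit_profile t).
Proof.
change (is_lim_seq (fun k => (mu - delta) * profile k t - H * profile k (t - sigma)
  + ricker rho (profile k (t - r))) (forcing limit_profile t)).
unfold forcing; apply is_lim_seq_plus'.
- apply is_lim_seq_minus'.
  + apply (is_lim_seq_scal_l _ (mu - delta) (limit_profile t)), profile_lim.
  + apply (is_lim_seq_scal_l _ H (limit_profile (t - sigma))), profile_lim.
- apply (is_lim_seq_continuous (ricker rho)); [| apply profile_lim].
  apply continuity_pt_filterlim, continuous_ricker.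
Qed.

(** The upper bound holds since [n' = g - mu n <= mu * kappa] along the iteration. *)
Lemma limit_profile_increment (s t : R) :
  s <= t -> 0 <= limit_profile t - limit_profile s <= mu * kappa * (t - s).
Proof.
intros hst.
assert (hlim : is_lim_seq (fun k => profile k t - profile k s)
  (limit_profile t - limit_profile s)).
{ apply is_lim_seq_minus'; apply profile_lim. }
split.
- apply (is_lim_seq_le (fun _ => 0) _ 0 (limit_profile t - limit_profile s))
    with (2 := is_lim_seq_const 0) (3 := hlim).
  intros k.
  generalize (proj1 (resolvent_nondecreasing _ (iterate_admissible k) s t hst)).
  unfold profile; lra.
- apply (is_lim_seq_le _ (fun _ => mu * kappa * (t - s))
    (limit_profile t - limit_profile s) (mu * kappa * (t - s)))
    with (2 := hlim) (3 := is_lim_seq_const _).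
  intros k.
  destruct (resolvent_admissible _ (iterate_admissible k)) as [hd hb].
  assert (h : mu * kappa * s - profile k s <= mu * kappa * t - profile k t).
  { apply (nondecreasing_of_derive_nonneg (fun u => mu * kappa * u - profile k u)
      (fun u => mu * kappa - (iterate k u - mu * profile k u))); [| | exact hst].
    - intros u; apply (is_derive_minus (fun u => mu * kappa * u) (profile k)).
      + auto_derive; [exact I | ring].
      + apply hd.
    - intros u; generalize (adm_le_equilibrium _ (iterate_admissible k) u).
      generalize (proj1 (hb u)) mu_pos; unfold profile; nra. }
  lra.
Qed.

Lemma forcing_limit_continuous (t : R) : continuous (forcing limit_profile) t.
Proof.
apply forcing_continuous.
apply continuous_of_lipschitz with (mu * kappa).
- apply Rlt_le, Rmult_lt_0_compat; [exact mu_pos | apply hkappa].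
- exact limit_profile_increment.
Qed.

(** [e^(mu t) n] has the nondecreasing derivative [e^(mu t) g]. *)
Lemma profile_secant_bounds (k : nat) (s t : R) :
  s <= t ->
  (t - s) * (exp (mu * s) * iterate k s)
  <= exp (mu * t) * profile k t - exp (mu * s) * profile k s
  <= (t - s) * (exp (mu * t) * iterate k t).
Proof.
intros hst.
assert (hg := iterate_admissible k).
destruct (resolvent_admissible _ hg) as [hd _].
assert (hN := damped_weighted _ _ _ hd).
destruct (MVT_gen (fun t => exp (mu * t) * profile k t) s t
  (fun t => exp (mu * t) * iterate k t)) as [c [hc heq]].
- intros x _; apply hN.
- intros x _; exact (is_derive_continuity_pt _ _ _ (hN x)).
- rewrite Rmin_left, Rmax_right in hc by exact hst.
  assert (hmono : forall x y, x <= y ->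
    exp (mu * x) * iterate k x <= exp (mu * y) * iterate k y).
  { intros x y hxy; apply Rmult_le_compat.
    - apply Rlt_le, exp_pos.
    - apply (adm_nonneg _ hg).
    - destruct hxy as [h | ->]; [| apply Rle_refl].
      apply Rlt_le, exp_increasing; generalize mu_pos; nra.
    - now apply (adm_nondecreasing _ hg). }
  rewrite heq; generalize (hmono s c (proj1 hc)) (hmono c t (proj2 hc)); nra.
Qed.

(** The index is shifted by one because [iterate (S k)] is the forcing of [profile k],
    so that its limit is known. *)
Lemma limit_profile_secant_bounds (s t : R) :
  s <= t ->
  (t - s) * (exp (mu * s) * forcing limit_profile s)
  <= exp (mu * t) * limit_profile t - exp (mu * s) * limit_profile s
  <= (t - s) * (exp (mu * t) * forcing limit_profile t).
Proof.
intros hst.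
assert (hN : is_lim_seq
  (fun k => exp (mu * t) * profile (S k) t - exp (mu * s) * profile (S k) s)
  (exp (mu * t) * limit_profile t - exp (mu * s) * limit_profile s)).
{ apply is_lim_seq_minus'.
  - apply (is_lim_seq_scal_l _ _ (limit_profile t)).
    apply (is_lim_seq_incr_1 (fun k => profile k t)), profile_lim.
  - apply (is_lim_seq_scal_l _ _ (limit_profile s)).
    apply (is_lim_seq_incr_1 (fun k => profile k s)), profile_lim. }
assert (hD : forall u, is_lim_seq
  (fun k => (t - s) * (exp (mu * u) * iterate (S k) u))
  ((t - s) * (exp (mu * u) * forcing limit_profile u))).
{ intros u; apply (is_lim_seq_scal_l _ _ (exp (mu * u) * forcing limit_profile u)).
  apply (is_lim_seq_scal_l _ _ (forcing limit_profile u)), iterate_lim. }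
split.
- exact (is_lim_seq_le _ _ _ _
    (fun k => proj1 (profile_secant_bounds (S k) s t hst)) (hD s) hN).
- exact (is_lim_seq_le _ _ _ _
    (fun k => proj2 (profile_secant_bounds (S k) s t hst)) hN (hD t)).
Qed.

Lemma limit_profile_derive (t : R) :
  is_derive limit_profile t (forcing limit_profile t - mu * limit_profile t).
Proof.
assert (hN : is_derive (fun t => exp (mu * t) * limit_profile t) t
  (exp (mu * t) * forcing limit_profile t)).
{ apply (is_derive_of_secant_bounds (fun t => exp (mu * t) * limit_profile t)
    (fun t => exp (mu * t) * forcing limit_profile t)).
  - intros u; apply (continuous_mult (fun u => exp (mu * u)));
      [| apply forcing_limit_continuous].
    apply (ex_derive_continuous (fun u => exp (mu * u))); auto_derive; exact I.
  - exact limit_profile_secant_bounds. }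
assert (hcancel : forall u x, exp (- (mu * u)) * (exp (mu * u) * x) = x).
{ intros u x; rewrite <- Rmult_assoc, <- exp_plus, Rplus_opp_l, exp_0; ring. }
apply is_derive_ext with
  (fun t => exp (- (mu * t)) * (exp (mu * t) * limit_profile t)).
- intros u; apply hcancel.
- evar_last.
  + apply (is_derive_mult (fun t => exp (- (mu * t)))); [| exact hN | exact Rmult_comm].
    auto_derive; [exact I | reflexivity].
  + unfold plus, mult; simpl.
    transitivity (exp (- (mu * t)) * (exp (mu * t) * forcing limit_profile t)
      - mu * (exp (- (mu * t)) * (exp (mu * t) * limit_profile t))); [ring |].
    now rewrite !hcancel.
Qed.

Lemma limit_profile_solution :
  is_entire_solution delta H rho sigma r limit_profile.
Proof.
intros t; generalize (limit_profile_derive t); unfold forcing, ricker.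
match goal with |- is_derive _ _ ?a -> is_derive _ _ ?b =>
  replace a with b by ring end.
easy.
Qed.

Lemma limit_profile_bounds (t : R) :
  0 <= limit_profile t <= kappa /\ sub_exp t <= limit_profile t <= super_exp t.
Proof.
split; apply limit_profile_between; intros k.
- apply (resolvent_admissible _ (iterate_admissible k)).
- apply (resolvent_between_exp _ (iterate_admissible k)).
Qed.

Lemma limit_profile_lim_m_infty : is_lim limit_profile m_infty 0.
Proof.
apply is_lim_le_le_loc with (fun _ => 0) super_exp.
- exists 0; intros t _; generalize (limit_profile_bounds t); lra.
- apply is_lim_const.
- apply is_lim_ext with (fun t => exp (lam * t + 0)).
  + intros t; unfold super_exp; f_equal; ring.
  + apply is_lim_comp_lin; [| lra].
    replace (Rbar_plus (Rbar_mult lam m_infty) 0) with m_infty.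
    * exact is_lim_exp_m.
    * simpl; destruct (Rle_dec 0 lam) as [h | h]; [| exfalso; lra].
      destruct (Rle_lt_or_eq_dec 0 lam h); [reflexivity | exfalso; lra].
Qed.

(** Where [e^(lam t) = 1 / (2 M)], the subsolution equals [1 / (4 M)]. *)
Lemma limit_profile_somewhere_pos : exists t, 0 < limit_profile t.
Proof.
exists (ln (/ (2 * M)) / lam).
apply Rlt_le_trans with (2 := proj1 (proj2 (limit_profile_bounds _))).
unfold sub_exp.
replace (lam * (ln (/ (2 * M)) / lam)) with (ln (/ (2 * M))) by (field; lra).
rewrite exp_ln by (apply Rinv_0_lt_compat; lra).
replace (/ (2 * M) - M * (/ (2 * M)) ^ 2) with (/ (4 * M)) by (field; lra).
apply Rinv_0_lt_compat; lra.
Qed.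

(** The limit [l] makes the right-hand side of the equation converge, necessarily to 0;
    so [l] is a positive equilibrium, and [rho e^(- l) = delta + H] determines it. *)
Lemma limit_profile_lim_p_infty : is_lim limit_profile p_infty kappa.
Proof.
destruct (is_lim_nondecreasing_bounded limit_profile kappa) as [l [hl hle]].
- intros s t hst; generalize (limit_profile_increment s t hst); lra.
- intros t; apply limit_profile_bounds.
- assert (hpos : 0 < l).
  { destruct limit_profile_somewhere_pos as [t ht]; generalize (hle t); lra. }
  assert (hzero : (mu - delta) * l - H * l + ricker rho l - mu * l = 0).
  { apply (derive_limit_zero limit_profile _ l _ limit_profile_derive hl).
    unfold forcing; apply is_lim_minus'.
    - apply is_lim_plus'; [apply is_lim_minus' |].
      + apply (is_lim_scal_l _ (mu - delta) p_infty l), hl.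
      + apply (is_lim_scal_l _ H p_infty l), is_lim_shift_p_infty, hl.
      + apply (filterlim_comp _ _ _ (fun t => limit_profile (t - r)) (ricker rho)
          _ (locally l)).
        * apply is_lim_shift_p_infty, hl.
        * apply continuous_ricker.
    - apply (is_lim_scal_l _ mu p_infty l), hl. }
  replace kappa with l; [exact hl |].
  assert (hexp : rho * exp (- l) = rho * exp (- kappa)).
  { apply Rmult_eq_reg_l with l; [| lra].
    rewrite hequil; unfold ricker in hzero; lra. }
  apply Rmult_eq_reg_l in hexp; [| lra].
  apply exp_inv in hexp; lra.
Qed.

Lemma limit_profile_derive_nonneg (t : R) : 0 <= Derive limit_profile t.
Proof.
assert (hder : derivable limit_profile).
{ intros u; eexists; apply is_derive_Reals, limit_profile_derive. }
rewrite <- (Derive_Reals limit_profile t (hder t)).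
apply nonneg_derivative_0.
intros x y hxy; generalize (limit_profile_increment x y hxy); lra.
Qed.

End MonotoneScheme.

(** * The characteristic rates *)

Lemma Rmult_le_neg_pos (x y : R) : x <= 0 -> 0 <= y -> x * y <= 0.
Proof. intros; nra. Qed.

Lemma subcritical_delay_bound (delta H sigma0 sigma : R) :
  0 < delta -> 0 < H -> critical_delay_eq delta H sigma0 ->
  0 < sigma -> sigma <= sigma0 -> H * sigma * exp (1 + delta * sigma) <= 1.
Proof.
intros hd hH [_ heq] hs hle; rewrite <- heq at 2.
apply Rmult_le_compat.
- apply Rmult_le_pos; lra.
- apply Rlt_le, exp_pos.
- apply Rmult_le_compat_l; lra.
- destruct hle as [h | ->]; [| apply Rle_refl].
  apply Rlt_le, exp_increasing; nra.
Qed.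

(** At [x = delta + 1 / sigma], the minimiser of [H e^(x sigma) - x] at the critical
    delay, the condition on [sigma] says that [x - delta >= H e^(x sigma)], while the
    reverse inequality holds at [x = delta]. *)
Lemma decay_rate_exists (delta H sigma : R) :
  0 < H -> 0 < sigma -> H * sigma * exp (1 + delta * sigma) <= 1 ->
  exists mu, mu - delta = H * exp (mu * sigma).
Proof.
intros hH hs hcrit.
assert (hinv : 0 < / sigma) by now apply Rinv_0_lt_compat.
destruct (IVT_cor (fun x => x - delta - H * exp (x * sigma)) delta (delta + / sigma))
  as [mu [_ hmu]].
- intros x; apply derivable_continuous_pt, ex_derive_Reals_0; auto_derive; exact I.
- lra.
- assert (h1 : 0 < H * exp (delta * sigma)).
  { apply Rmult_lt_0_compat; [exact hH | apply exp_pos]. }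
  replace ((delta + / sigma) * sigma) with (1 + delta * sigma) by (field; lra).
  assert (h2 : H * exp (1 + delta * sigma) <= / sigma).
  { apply Rmult_le_reg_l with sigma; [exact hs |].
    rewrite Rinv_r by lra; lra. }
  apply Rmult_le_neg_pos; lra.
- exists mu; lra.
Qed.

(** The characteristic function is negative at 0, where it equals [delta + H - rho],
    and positive at [rho]. *)
Lemma growth_rate_exists (delta rho H sigma r : R) :
  0 < delta -> 0 < H -> 0 < r -> delta + H < rho ->
  exists lam, 0 < lam /\
    lam + delta + H * exp (- (lam * sigma)) = rho * exp (- (lam * r)).
Proof.
intros hd hH hr hrho.
destruct (IVT_cor (fun x => x + delta + H * exp (- (x * sigma)) - rho * exp (- (x * r)))
  0 rho) as [lam [[hlam _] heq]].
- intros x; apply derivable_continuous_pt, ex_derive_Reals_0; auto_derive; exact I.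
- lra.
- rewrite !Rmult_0_l, Ropp_0, exp_0.
  assert (h1 : 0 < H * exp (- (rho * sigma))).
  { apply Rmult_lt_0_compat; [exact hH | apply exp_pos]. }
  assert (h2 : exp (- (rho * r)) < 1).
  { rewrite <- exp_0; apply exp_increasing; nra. }
  assert (h3 : rho * exp (- (rho * r)) < rho * 1) by (apply Rmult_lt_compat_l; lra).
  apply Rmult_le_neg_pos; lra.
- exists lam; split; [| lra].
  destruct hlam as [h | <-]; [exact h | exfalso].
  rewrite !Rmult_0_l, Ropp_0, exp_0 in heq; lra.
Qed.

(** From [lam] to [2 lam] the characteristic function grows: the only decreasing term
    loses at most [H lam sigma < lam], since [1 - e^(-x) <= x]. *)
Lemma characteristic_double_pos (delta rho H sigma r lam : R) :
  0 < rho -> 0 < H -> 0 < sigma -> 0 < r -> H * sigma < 1 -> 0 < lam ->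
  lam + delta + H * exp (- (lam * sigma)) = rho * exp (- (lam * r)) ->
  0 < 2 * lam + delta + H * exp (- (lam * sigma)) ^ 2 - rho * exp (- (lam * r)) ^ 2.
Proof.
intros hrho hH hs hr hHs hlam heq.
assert (h01 : forall x, 0 < x -> 0 < exp (- x) < 1).
{ intros x hx; split; [apply exp_pos |].
  rewrite <- exp_0; apply exp_increasing; lra. }
generalize (h01 _ (Rmult_lt_0_compat _ _ hlam hs)) (exp_ineq1_le (- (lam * sigma))).
generalize (h01 _ (Rmult_lt_0_compat _ _ hlam hr)).
set (a := exp (- (lam * r))) in *; set (b := exp (- (lam * sigma))) in *.
intros ha hb hb'.
assert (h1 : 0 < rho * (a * (1 - a))) by (apply Rmult_lt_0_compat; nra).
assert (h2 : b * (1 - b) <= lam * sigma) by nra.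
assert (h3 : H * (b * (1 - b)) <= H * (lam * sigma)) by (apply Rmult_le_compat_l; lra).
assert (h4 : lam * (H * sigma) < lam * 1) by (apply Rmult_lt_compat_l; lra).
nra.
Qed.

Lemma positive_equilibrium (delta rho H : R) :
  0 < delta -> 0 < H -> 1 < rho / (delta + H) <= exp 1 ->
  0 < ln (rho / (delta + H)) <= 1 /\
  rho * exp (- ln (rho / (delta + H))) = delta + H.
Proof.
intros hd hH [h1 h2]; split; [split |].
- rewrite <- ln_1; apply ln_increasing; lra.
- rewrite <- (ln_exp 1); apply ln_le; lra.
- rewrite exp_Ropp, exp_ln by lra; field.
  split; [lra |].
  intros ->; unfold Rdiv in h1; rewrite Rmult_0_l in h1; lra.
Qed.

(** * The heteroclinic solution *)

Theorem theorem4 :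
  forall delta rho H kappa sigma0 r sigma : R,
    0 < delta -> 0 < rho -> 0 < H ->
    1 < rho / (delta + H) <= exp 1 ->
    kappa = ln (rho / (delta + H)) ->
    unique (critical_delay_eq delta H) sigma0 ->
    0 < r -> r <= sigma -> sigma <= sigma0 ->
    exists n : R -> R,
      is_heteroclinic delta H rho sigma r 0 kappa n /\
      (forall t : R, 0 <= Derive n t).
Proof.
intros delta rho H kappa sigma0 r sigma hd hrho hH hq hkappa [hs0 _] hr hrs hss.
destruct (positive_equilibrium delta rho H hd hH hq) as [hk hequil].
rewrite <- hkappa in hk, hequil.
assert (hs : 0 < sigma) by lra.
assert (hcrit := subcritical_delay_bound delta H sigma0 sigma hd hH hs0 hs hss).
destruct (decay_rate_exists delta H sigma hH hs hcrit) as [mu hmu].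
assert (hlt : delta + H < rho) by (destruct hq as [h _]; apply Rlt_div_r in h; lra).
destruct (growth_rate_exists delta rho H sigma r hd hH hr hlt) as [lam [hlam hchar]].
assert (hHs : H * sigma < 1).
{ assert (0 < H * sigma) by now apply Rmult_lt_0_compat.
  assert (1 < exp (1 + delta * sigma)).
  { rewrite <- exp_0 at 1; apply exp_increasing.
    generalize (Rmult_lt_0_compat _ _ hd hs); lra. }
  nra. }
assert (hdouble := characteristic_double_pos delta rho H sigma r lam
  hrho hH hs hr hHs hlam hchar).
set (D2 := 2 * lam + delta + H * exp (- (lam * sigma)) ^ 2
  - rho * exp (- (lam * r)) ^ 2) in *.
assert (hmupos : 0 < mu).
{ generalize (Rmult_lt_0_compat _ _ hH (exp_pos (mu * sigma))); lra. }
assert (hmk : 0 < mu * kappa) by (apply Rmult_lt_0_compat; lra).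
(* [M1] and [M2] are the least values of [M] meeting one condition each. *)
set (M1 := rho * exp (- (lam * r)) ^ 2 / D2).
set (M2 := (lam + mu) ^ 2 / (4 * (2 * lam + mu) * (mu * kappa))).
assert (hden : 0 < 4 * (2 * lam + mu) * (mu * kappa)).
{ apply Rmult_lt_0_compat; lra. }
assert (hM1 : 0 < M1).
{ apply Rdiv_lt_0_compat; [| exact hdouble].
  apply Rmult_lt_0_compat; [exact hrho | apply pow_lt, exp_pos]. }
assert (hM2 : 0 < M2) by (apply Rdiv_lt_0_compat; [apply pow_lt; lra | exact hden]).
assert (hM : 0 < M1 + M2) by lra.
assert (hM_sub : rho * exp (- (lam * r)) ^ 2 <= (M1 + M2) * D2).
{ replace (rho * exp (- (lam * r)) ^ 2) with (M1 * D2) by (unfold M1; field; lra).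
  apply Rmult_le_compat_r; lra. }
assert (hM_top : (lam + mu) ^ 2 <= 4 * ((M1 + M2) * (2 * lam + mu)) * (mu * kappa)).
{ replace ((lam + mu) ^ 2) with (M2 * (4 * (2 * lam + mu) * (mu * kappa)))
    by (unfold M2; field; lra).
  replace (4 * ((M1 + M2) * (2 * lam + mu)) * (mu * kappa))
    with ((M1 + M2) * (4 * (2 * lam + mu) * (mu * kappa))) by ring.
  apply Rmult_le_compat_r; lra. }
assert (heq : forall a, a = 0 \/ a = kappa -> is_equilibrium delta H rho sigma r a).
{ intros a ha t; evar_last; [apply is_derive_const |].
  change (0 = - delta * a - H * a + rho * a * exp (- a)).
  destruct ha as [-> | ->]; [ring |].
  replace (rho * kappa * exp (- kappa)) with (kappa * (rho * exp (- kappa))) by ring.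
  rewrite hequil; ring. }
exists (limit_profile delta rho H sigma r kappa mu lam).
split; [split; [| split; [| split; [| split]]] |].
- apply heq; now left.
- apply heq; now right.
- now apply limit_profile_solution with (M := M1 + M2).
- now apply limit_profile_lim_m_infty with (M := M1 + M2).
- now apply limit_profile_lim_p_infty with (M := M1 + M2).
- now apply limit_profile_derive_nonneg with (M := M1 + M2).
Qed.
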